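(* Let $g$ and $\kappa$ be non-negative integers such that $2g \leq 3\kappa$. Then $\phi(G) \in \mathcal{G}_{\kappa+1}(g+1)$ for every $G \in \mathcal{G}_\kappa(g)$, and the map $\varphi: \mathcal{G}_\kappa(g) \to \mathcal{G}_{\kappa+1}(g+1)$, $G \mapsto \varphi(G) = \phi(G)$, is bijective.
   Context: $\mathbb{N}$ denotes the positive integers. A gapset is a finite set $G \subset \mathbb{N}$ such that whenever $z \in G$ and $z = x+y$ with $x,y \in \mathbb{N}$, then $x \in G$ or $y \in G$. The genus of $G$ is its cardinality $g$; we write $G = \{\ell_1 < \ell_2 < \cdots < \ell_g\}$. For $g \geq 2$, $G$ is pure $\kappa$-sparse if $\ell_{i+1}-\ell_i \leq \kappa$ for all $i \in \{1,\dots,g-1\}$ and $\ell_{i+1}-\ell_i = \kappa$ for some $i$. By convention, $\emptyset$ is pure $0$-sparse and $\{1\}$ is pure $1$-sparse (and for no other value of the parameter). $\mathcal{G}_\kappa(g)$ denotes the set of all pure $\kappa$-sparse gapsets of genus $g$. The map $\phi$: for $G = \{\ell_1 < \cdots < \ell_g\} \in \mathcal{G}_\kappa(g)$ with $g \geq 2$, let $\alpha := \max\{i : \ell_{i+1}-\ell_i = \kappa\}$ and $$\phi(G) := \{1\} \cup \{\ell_i + 1 : 1 \leq i \leq \alpha\} \cup \{\ell_i + 2 : \alpha+1 \leq i \leq g\}.$$ By convention $\phi(\emptyset) = \{1\}$ and $\phi(\{1\}) = \{1,3\}$. *)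

(* Defs.v *)
From mathcomp Require Import all_boot all_order finmap.
From mathcomp Require Import boolp classical_sets functions.

Set Implicit Arguments.
Unset Strict Implicit.
Unset Printing Implicit Defensive.

Local Open Scope fset_scope.
Local Open Scope nat_scope.

(* Gapsets are sets of positive integers, so 0 is excluded explicitly. *)
Definition gapset (G : {fset nat}) : Prop :=
  (forall z, z \in G -> 0 < z) /\
  (forall x y, 0 < x -> 0 < y -> x + y \in G -> x \in G \/ y \in G).

Definition genus (G : {fset nat}) : nat := #|` G|.

(* [gap G i] is the i-th smallest element of G, numbered from 1; only the
   indices 1 <= i <= genus G are meaningful. *)
Definition gap (G : {fset nat}) (i : nat) : nat :=
  nth 0 (sort leq (enum_fset G)) i.-1.

(* The truncated subtraction is exact: [gap G] is increasing on 1..genus G. *)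
Definition pure_sparse (kappa : nat) (G : {fset nat}) : Prop :=
  [\/ G = fset0 /\ kappa = 0,
      G = [fset 1] /\ kappa = 1
    | [/\ 2 <= genus G,
          (forall i, 1 <= i < genus G -> gap G i.+1 - gap G i <= kappa)
        & (exists2 i, 1 <= i < genus G & gap G i.+1 - gap G i = kappa)]].

Definition pure_sparse_gapsets (kappa g : nat) : set {fset nat} :=
  [set G | [/\ gapset G, genus G = g & pure_sparse kappa G]]%classic.

(* When G is pure kappa-sparse of genus at least 2 the index set is nonempty,
   so the default value 0 of the maximum is never reached. *)
Definition last_jump (kappa : nat) (G : {fset nat}) : nat :=
  \max_(1 <= i < genus G | gap G i.+1 - gap G i == kappa) i.

Definition phi (kappa : nat) (G : {fset nat}) : {fset nat} :=
  if G == fset0 then [fset 1]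
  else if G == [fset 1] then [fset 1; 3]
  else let alpha := last_jump kappa G in
    [fset 1]
    `|` [fset gap G i + 1 | i in index_iota 1 alpha.+1]
    `|` [fset gap G i + 2 | i in index_iota alpha.+1 (genus G).+1].

(* Main.v *)
(* Say that s < t is a k-jump of a gapset G when s and t = s + k are
   consecutive elements of G.  Splitting t = j + (t - j) with j < k forces
   1, ..., k - 1 into G, so s >= k - 1 and t >= 2k - 1; splitting z in G in all
   ways gives z <= 2g - 1, and 2g - 1 <= 3k - 1 under the hypothesis.  Hence
   nothing of G lies much further than k above t.  Consequently phi, which
   shifts G by 1 up to the last k-jump and by 2 beyond it and adds the element
   1, preserves and reflects the gapset property: a sum x + y of non-gaps is
   either below the jump, too small to be a sum of two non-gaps, or comes from
   two summands below t, where the shift by 2 distributes as 1 + 1.  The same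
   bounds show that in the image every jump after the (k+1)-jump is shorter
   than k, so the place of the jump, and with it G, can be recovered. *)
Require Import Defs.
From mathcomp Require Import all_boot all_order finmap.
From mathcomp Require Import boolp classical_sets functions.
From mathcomp Require Import zify.

(** * Consecutive elements without indices *)

Definition jump (G : {fset nat}) (a b : nat) : Prop :=
  [/\ a \in G, b \in G, a < b & forall x, a < x < b -> x \notin G].

Lemma size_gaps (G : {fset nat}) : size (sort leq (enum_fset G)) = genus G.
Proof. by rewrite size_sort. Qed.

Lemma gap_mem (G : {fset nat}) i : 1 <= i <= genus G -> gap G i \in G.
Proof.
move=> hi; rewrite /gap.
suff: nth 0 (sort leq (enum_fset G)) i.-1 \in sort leq (enum_fset G).
  by rewrite mem_sort.
by apply: mem_nth; rewrite size_gaps; lia.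
Qed.

Lemma gap_ltn (G : {fset nat}) i j :
  1 <= i -> i < j -> j <= genus G -> gap G i < gap G j.
Proof.
move=> hi hij hj; rewrite /gap.
have srt : sorted ltn (sort leq (enum_fset G)).
  by rewrite ltn_sorted_uniq_leq sort_uniq fset_uniq (sort_sorted leq_total).
by apply: (sorted_ltn_nth ltn_trans) => //; rewrite ?inE ?size_gaps; lia.
Qed.

Lemma gap_surj {G : {fset nat}} {x} :
  x \in G -> exists2 i, 1 <= i <= genus G & gap G i = x.
Proof.
move=> xG; have xs : x \in sort leq (enum_fset G) by rewrite mem_sort.
exists (index x (sort leq (enum_fset G))).+1; last by rewrite /gap /= nth_index.
by move: xs; rewrite -index_mem size_gaps.
Qed.

Lemma gap_jump (G : {fset nat}) i :
  1 <= i < genus G -> jump G (gap G i) (gap G i.+1).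
Proof.
move=> hi; split; try by apply: gap_mem; lia.
  by apply: gap_ltn; lia.
move=> x hx; apply/negP => /gap_surj [j hj xE]; subst x.
have [ji|ij|e] := ltngtP j i; last by subst j; lia.
  have := gap_ltn G j i; lia.
have [e|ne] := eqVneq j i.+1; first by subst j; lia.
have := gap_ltn G i.+1 j; lia.
Qed.

Lemma jump_gap {G : {fset nat}} {a b} : jump G a b ->
  exists2 i, 1 <= i < genus G & gap G i = a /\ gap G i.+1 = b.
Proof.
move=> [aG bG ab nb].
have [i hi iE] := gap_surj aG; have [j hj jE] := gap_surj bG.
have ij : i < j.
  case: (ltngtP i j) => // [ji|e]; last by subst j; lia.
  have := gap_ltn G j i; lia.
exists i; first by lia.
split=> //; have [<- //|ne] := eqVneq j i.+1.
have /negP[] : gap G i.+1 \notin G.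
  apply: nb; have := gap_ltn G i i.+1; have := gap_ltn G i.+1 j; lia.
by apply: gap_mem; lia.
Qed.

(** Genus at least 2 discards the two conventional cases, and the additive form [b <= a + k] avoids
    truncated subtraction. *)
Lemma pure_sparseP (k : nat) (G : {fset nat}) : 2 <= genus G ->
  pure_sparse k G <->
  (forall a b, jump G a b -> b <= a + k) /\ (exists a, jump G a (a + k)).
Proof.
move=> g2; split.
  case=> [[G0 _]|[G1 _]|[_ le_k [i hi iE]]].
  - by move: g2; rewrite /genus G0 cardfs0.
  - by move: g2; rewrite /genus G1 cardfs1.
  split.
    by move=> a b /jump_gap[j hj [<- <-]]; have := le_k j hj; lia.
  exists (gap G i); have := gap_jump G i hi.
  suff -> : gap G i.+1 = gap G i + k by [].
  by have := gap_ltn G i i.+1; lia.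
move=> [le_k [a /jump_gap[i hi [iE iE']]]]; apply: Or33; split=> //.
  by move=> j /gap_jump/le_k; lia.
by exists i => //; lia.
Qed.

(** * The shift as a map on all naturals *)

Definition shift (s x : nat) : nat := x + 1 + (s < x).

(** Form of [phi] whose threshold is a value s rather than an index, so that it acts through one
    strictly increasing map that does not depend on G. *)
Definition insert_shift (s : nat) (G : {fset nat}) : {fset nat} :=
  (1 |` [fset shift s x | x in G])%fset.

Lemma shift_ltn s x y : (shift s x < shift s y) = (x < y).
Proof. by rewrite /shift; lia. Qed.

Lemma shift_inj s : injective (shift s).
Proof. by move=> x y; rewrite /shift; lia. Qed.

Lemma mem_insert_shiftP s (G : {fset nat}) y :
  reflect (y = 1 \/ exists2 x, x \in G & y = shift s x)
    (y \in insert_shift s G).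
Proof.
rewrite in_fset1U; apply: (iffP orP) => -[/eqP ->|]; try by left.
  by case/imfsetP => x /= xG ->; right; exists x.
by case=> x xG ->; right; apply/imfsetP; exists x.
Qed.

Lemma mem_shift s (G : {fset nat}) x :
  0 < x -> (shift s x \in insert_shift s G) = (x \in G).
Proof.
move=> x0; apply/mem_insert_shiftP/idP => [[|[y yG /shift_inj -> //]]|xG].
  by rewrite /shift; lia.
by right; exists x.
Qed.

Lemma genus_insert_shift s (G : {fset nat}) :
  0 \notin G -> genus (insert_shift s G) = (genus G).+1.
Proof.
move=> G0; rewrite /genus cardfsU1 card_imfset; last exact: shift_inj.
suff -> : 1 \notin [fset shift s x | x in G]%fset by [].
apply/negP => /imfsetP[x /= xG]; rewrite /shift => e.
by have x0 : x = 0 by [lia]; move: xG; rewrite x0 (negPf G0).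
Qed.

Lemma jump_shift s (G : {fset nat}) a b : 0 \notin G -> 0 < a -> 0 < b ->
  jump (insert_shift s G) (shift s a) (shift s b) <-> jump G a b.
Proof.
move=> G0 a0 b0; rewrite /jump !mem_shift // shift_ltn.
split=> -[aG bG ab nb]; split=> // x hx.
  have x0 : 0 < x by lia.
  by rewrite -(mem_shift s) //; apply: nb; rewrite !shift_ltn.
apply/negP => /mem_insert_shiftP [x1|[y yG xE]].
  by move: hx; rewrite x1 /shift; lia.
by move: hx; rewrite xE !shift_ltn => /nb; rewrite yG.
Qed.

Definition last_jump_at (k : nat) (G : {fset nat}) (s : nat) : Prop :=
  jump G s (s + k) /\ (forall a, s < a -> ~ jump G a (a + k)).

Lemma last_jump_at_exists (k : nat) (G : {fset nat}) :
  (exists a, jump G a (a + k)) -> exists s, last_jump_at k G s.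
Proof.
case=> a ja.
have ex : exists a, (fun a => `[< jump G a (a + k) >]) a by exists a; apply/asboolP.
have ub : forall a, `[< jump G a (a + k) >] -> a <= \max_(x <- G) x.
  by move=> b /asboolP[bG _ _ _]; apply: (bigmaxn_sup_seq b).
case: (ex_maxnP ex ub) => s /asboolP js smax; exists s; split=> // b sb /asboolP/smax.
by lia.
Qed.

Lemma phiE (k s : nat) (G : {fset nat}) :
  2 <= genus G -> last_jump_at k G s -> phi k G = insert_shift s G.
Proof.
move=> g2 [js smax]; rewrite /phi.
have -> : (G == fset0) = false.
  by apply/eqP => G0; move: g2; rewrite /genus G0 cardfs0.
have -> : (G == [fset 1]%fset) = false.
  by apply/eqP => G1; move: g2; rewrite /genus G1 cardfs1.
have [i hi [iE iE']] := jump_gap js.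
have -> : last_jump k G = i.
  apply/eqP; rewrite eqn_leq; apply/andP; split.
    apply/bigmax_leqP_seq => j; rewrite mem_index_iota => hj /eqP jk.
    rewrite leqNgt; apply/negP => ij.
    apply: (smax (gap G j)); first by rewrite -iE; apply: gap_ltn; lia.
    have -> : gap G j + k = gap G j.+1 by have := gap_ltn G j j.+1; lia.
    exact: gap_jump.
  apply: (bigmaxn_sup_seq i) => //; first by rewrite mem_index_iota.
  by apply/eqP; lia.
(* Comparing values with s amounts to comparing indices with i, so [shift s] adds 1 up to index i
   and 2 beyond it, as [phi] does. *)
have le_s j : 1 <= j <= genus G -> (s < gap G j) = (i < j).
  move=> hj; rewrite -iE; have [ij|ji|->] := ltngtP i j; last by rewrite ltnn.
    by apply: gap_ltn; lia.
  by have := gap_ltn G j i; lia.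
apply/fsetP => y; apply/idP/mem_insert_shiftP.
  rewrite !inE -orbA => /or3P[/eqP ->|/imfsetP[j]|/imfsetP[j]]; first by left.
    rewrite /= mem_index_iota => hj ->; right; exists (gap G j).
      by apply: gap_mem; lia.
    by rewrite /shift le_s; lia.
  rewrite /= mem_index_iota => hj ->; right; exists (gap G j).
    by apply: gap_mem; lia.
  by rewrite /shift le_s; lia.
rewrite !inE -orbA => -[->//|[x /gap_surj[j hj <-] ->]].
apply/or3P; rewrite /shift le_s //; have [ij|ji] := ltnP i j.
  apply: Or33; apply/imfsetP; exists j; last by rewrite /=; lia.
  by rewrite /= mem_index_iota; lia.
apply: Or32; apply/imfsetP; exists j; last by rewrite /=; lia.
by rewrite /= mem_index_iota; lia.
Qed.

(** * Bounds on gaps and on jumps *)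

(** For each x in 1..z-1, x or z - x is an element of G other than z. So two copies of the g - 1
    other elements cover z - 1 values, and z - 1 <= 2(g - 1). *)
Lemma gapset_max {G : {fset nat}} {z} : gapset G -> z \in G -> z < 2 * genus G.
Proof.
move=> [pos split_G] zG; have z0 := pos z zG.
pose A := (G `\ z)%fset.
have cA : size (enum_fset A) = (genus G).-1.
  by rewrite /genus (cardfsD1 z G) zG.
have sub : {subset iota 1 z.-1 <= enum_fset A ++ [seq z - x | x <- enum_fset A]}.
  move=> x; rewrite mem_iota mem_cat => hx.
  have [xG|xG] : x \in G \/ z - x \in G.
  - by apply: split_G; rewrite ?subnKC //; lia.
  - apply/orP; left; rewrite /A !inE xG andbT; lia.
  apply/orP; right; apply/mapP; exists (z - x); last by lia.
  rewrite /A !inE xG andbT; lia.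
have := uniq_leq_size (iota_uniq _ _) sub.
rewrite size_iota size_cat size_map cA.
suff : 0 < genus G by lia.
by rewrite /genus cardfs_gt0; apply/fset0Pn; exists z.
Qed.

Lemma gapset_split {G : {fset nat}} {z} x y :
  gapset G -> z \in G -> 0 < x -> 0 < y -> x + y = z -> x \in G \/ y \in G.
Proof. by move=> [_ split_G] zG x0 y0 xyz; apply: split_G; rewrite ?xyz. Qed.

Lemma below_jump {G : {fset nat}} {s k j} :
  gapset G -> jump G s (s + k) -> 0 < j < k -> j \in G.
Proof.
move=> gG [_ tG _ nb] hj.
have [//|] := gapset_split j (s + k - j) gG tG ltac:(lia) ltac:(lia) ltac:(lia).
by rewrite (negPf (nb _ _)) //; lia.
Qed.

(** Otherwise k - 1 would lie strictly inside the jump, yet [below_jump] puts it in G. *)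
Lemma jump_lower {G : {fset nat}} {s k} :
  gapset G -> jump G s (s + k) -> k <= s.+1.
Proof.
move=> gG js; rewrite leqNgt; apply/negP => sk.
have := below_jump gG js; case: js => sG _ _ nb.
have s0 := proj1 gG s sG.
by move=> /(_ k.-1 ltac:(lia)); apply/negP/nb; lia.
Qed.

(** * The shift preserves and reflects gapsets *)

Lemma gapset_insert_shift {G : {fset nat}} {s k} :
  gapset G -> 2 * genus G <= 3 * k -> 2 <= genus G -> last_jump_at k G s ->
  gapset (insert_shift s G).
Proof.
move=> gG hgk g2 [js smax]; have [pos _] := gG.
have [sG tG _ nb] := js.
have sk := jump_lower gG js; have t2 := gapset_max gG tG.
have s0 := pos s sG.
split=> [z /mem_insert_shiftP[->//|[x _ ->]]|x y x0 y0 xyH].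
  by rewrite /shift; lia.
have memH z : z \in G -> shift s z \in insert_shift s G.
  by move=> zG; rewrite mem_shift // pos.
have small z : 0 < z <= k -> z \in insert_shift s G.
  move=> hz; have [->|z1] := eqVneq z 1; first by apply/mem_insert_shiftP; left.
  have -> : z = shift s z.-1 by rewrite /shift; lia.
  by apply: memH; apply: (below_jump gG js); lia.
apply/orP; case: (boolP (x \in _)) => //= xH; apply: contraT => yH.
have kx : k < x by rewrite ltnNge; apply: contra xH => ?; apply: small; lia.
have ky : k < y by rewrite ltnNge; apply: contra yH => ?; apply: small; lia.
have {xyH} [z zG xyE] : exists2 z, z \in G & x + y = shift s z.
  by case/mem_insert_shiftP: xyH => // h; lia.
have z2 := gapset_max gG zG.
(* The bound s + k <= 3k - 1 gives s <= 2k - 1; z <= s would make x + y = z + 1 <= 2k, against x, y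
   > k. *)
have sz : s < z by rewrite ltnNge; apply/negP => zs; rewrite /shift in xyE; lia.
have tz : s + k <= z.
  by rewrite leqNgt; apply/negP => zt; have := nb z; rewrite zG => /(_ ltac:(lia)).
have pred_notin w : 1 < w <= s + k -> w \notin insert_shift s G -> w.-1 \notin G.
  move=> hw; case: (leqP w.-1 s) => ws; last by move=> _; apply: nb; lia.
  apply: contra => /memH; have -> // : shift s w.-1 = w by rewrite /shift; lia.
have {}xyE : x + y = z + 2 by rewrite xyE /shift; lia.
(* The bounds leave one extremal configuration when a summand exceeds t. *)
have tight : z.+1 = 3 * k -> s.+1 = k -> False.
  move=> zk sk1; have [k2|k3] : k = 2 \/ 2 < k by lia.
    apply: (smax z.-2); first by lia.
    have -> : z.-2 + k = z by lia.
    have e : z.-2 = s + k by lia.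
    rewrite e; split=> //; first by lia.
    move=> u hu; apply/negP => uG.
    have [] := gapset_split 2 2 gG uG ltac:(lia) ltac:(lia) ltac:(lia);
      by apply/negP/nb; lia.
  (* The jump is from k - 1 to 2k - 1; both summands of z = 3k - 1 lie strictly inside it, since k >
     2. *)
  have [] := gapset_split (k + k - 2) k.+1 gG zG ltac:(lia) ltac:(lia) ltac:(lia);
    by apply/negP/nb; lia.
have [xt|tx] := leqP x (s + k); have [yt|ty] := leqP y (s + k).
(* Here z = (x - 1) + (y - 1), and neither summand is in G. *)
- have [] := gapset_split x.-1 y.-1 gG zG ltac:(lia) ltac:(lia) ltac:(lia);
    by apply: contraTT => _; apply: pred_notin => //; lia.
(* If one summand exceeds s + k, the other being at least k + 1, then z >= s + 2k >= 3k - 1, so the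
   bound z <= 3k - 1 is attained. *)
all: by case: tight; lia.
Qed.

(* The negation forces s = k - 1 and b = 3k - 2, but b = k + (2k - 2) is then a
   sum of two elements strictly inside the jump. *)
Lemma gap_after_jump {H : {fset nat}} {s k a b} :
  gapset H -> 2 * genus H < 3 * k -> 1 < k ->
  jump H s (s + k) -> jump H a b -> s < a -> b.+1 < a + k.
Proof.
move=> gH hgk k1 js [aH bH ab _] sa; rewrite ltnNge; apply/negP => kb.
have sk := jump_lower gH js; have b2 := gapset_max gH bH.
have [_ _ _ nb] := js.
have ta : s + k <= a.
  by rewrite leqNgt; apply/negP => at_; have := nb a; rewrite aH => /(_ ltac:(lia)).
have [] := gapset_split k (k + k - 2) gH bH ltac:(lia) ltac:(lia) ltac:(lia);
  by apply/negP/nb; lia.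
Qed.

(** On positive arguments [shift s] misses exactly 0, 1 and s + 2; [u] inverts it on the remaining
    values. *)
Lemma insert_shift_onto {H : {fset nat}} {s} :
  0 \notin H -> 1 \in H -> s.+2 \notin H ->
  exists2 G : {fset nat}, 0 \notin G & H = insert_shift s G.
Proof.
move=> H0 H1 Hs; pose u y := y - 1 - (s.+1 < y).
have uK y : y \in H -> y != 1 -> 0 < u y /\ shift s (u y) = y.
  move=> yH y1.
  have y0 : y != 0 by apply: contraNneq H0 => <-.
  have ys : y != s.+2 by apply: contraNneq Hs => <-.
  by rewrite /u /shift; lia.
exists [fset u y | y in (H `\ 1)%fset]%fset.
  apply/negP => /imfsetP[y /=]; rewrite !inE => /andP[y1 yH].
  by have [] := uK y yH y1; lia.
apply/fsetP => y; apply/idP/mem_insert_shiftP => [yH|].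
  have [->|y1] := eqVneq y 1; first by left.
  right; exists (u y); last by have [] := uK y yH y1.
  by apply/imfsetP; exists y; rewrite //= !inE y1.
case=> [->//|[x /imfsetP[z /=]]]; rewrite !inE => /andP[z1 zH] -> ->.
by have [_ ->] := uK z zH z1.
Qed.

Lemma gapset_insert_shift_inv {G : {fset nat}} {s k} :
  0 \notin G -> gapset (insert_shift s G) -> 2 * genus G <= 3 * k ->
  jump G s (s + k) -> gapset G.
Proof.
move=> G0 gH hgk js; have gHE := genus_insert_shift s G G0.
have pos z : z \in G -> 0 < z by case: z => //; rewrite (negPf G0).
split=> // x y x0 y0 zG; have [sG tG st nb] := js.
have jH : jump (insert_shift s G) s.+1 (s.+1 + k.+1).
  have <- : shift s s = s.+1 by rewrite /shift; lia.
  have -> : shift s s + k.+1 = shift s (s + k) by rewrite /shift; lia.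
  by apply/jump_shift => //; apply: pos.
have [_ tH _ nbH] := jH.
have sk := jump_lower gH jH; have t2 := gapset_max gH tH.
have small j : 0 < j < k -> j \in G.
  move=> hj; rewrite -(mem_shift s); last by lia.
  by apply: (below_jump gH jH); rewrite /shift; lia.
apply/orP; case: (boolP (x \in _)) => //= xG; apply: contraT => yG.
have kx : k <= x by rewrite leqNgt; apply: contra xG => ?; apply: small; lia.
have ky : k <= y by rewrite leqNgt; apply: contra yG => ?; apply: small; lia.
have zH : shift s (x + y) \in insert_shift s G by rewrite mem_shift // pos.
have z2 := gapset_max gH zH.
have sz : s < x + y by lia.
have tz : s + k <= x + y.
  by rewrite leqNgt; apply/negP => zt; have := nb (x + y); rewrite zG => /(_ ltac:(lia)).
have zE : x.+1 + y.+1 = shift s (x + y) by rewrite /shift; lia.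
have succ_notin w : 0 < w <= s + k -> w \notin G -> w.+1 \notin insert_shift s G.
  move=> hw wG; case: (leqP w s) => ws; last by apply: nbH; lia.
  have -> : w.+1 = shift s w by rewrite /shift; lia.
  by rewrite mem_shift //; lia.
(* The bound in the image gives x + y <= 3k - 1; with y >= k and s >= k - 1 this yields x <= 2k - 1
   <= s + k, so no extremal case arises in this direction. *)
have xt : x <= s + k by lia.
have yt : y <= s + k by lia.
have [] := gapset_split x.+1 y.+1 gH zH isT isT zE;
  by apply: contraTT => _; apply: succ_notin => //; lia.
Qed.

(** * The bijection in genus at least 2 *)

Lemma phi_pure_sparse {k g : nat} {G : {fset nat}} :
  2 * g <= 3 * k -> 2 <= g -> pure_sparse_gapsets k g G ->
  exists s, [/\ jump G s (s + k), phi k G = insert_shift s G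
    & pure_sparse_gapsets k.+1 g.+1 (insert_shift s G)].
Proof.
move=> hgk g2 [gG gE psG]; rewrite -gE in hgk g2 *.
move: psG => /(pure_sparseP _ _ g2) [le_k /last_jump_at_exists[s sl]].
have js := sl.1; have [pos _] := gG.
have G0 : 0 \notin G by apply/negP => /pos.
have [sG tG st nb] := js.
have s0 := pos s sG.
exists s; split=> //; first exact: phiE.
split; [exact: gapset_insert_shift sl | exact: genus_insert_shift |].
apply/pure_sparseP; first by rewrite genus_insert_shift //; lia.
split=> [a b [aH bH ab nbH]|]; last first.
  exists s.+1; have -> : s.+1 + k.+1 = shift s (s + k) by rewrite /shift; lia.
  have -> : s.+1 = shift s s by rewrite /shift; lia.
  by apply/jump_shift => //; lia.
(* The added element 1 has no positive preimage, so a jump starting there needs a separate argument: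
   it ends at 2, because 1 is in G (k >= 2). *)
have H2 : 2 \in insert_shift s G.
  have -> : 2 = shift s 1 by rewrite /shift; lia.
  by rewrite mem_shift //; apply: (below_jump gG js); lia.
case/mem_insert_shiftP: (aH) => [a1|[a' a'G aE]].
  rewrite leqNgt; apply/negP => hb.
  by have := nbH 2 ltac:(lia); rewrite H2.
have a'0 := pos _ a'G.
case/mem_insert_shiftP: (bH) => [b1|[b' b'G bE]].
  by move: ab; rewrite aE b1 /shift; lia.
have jab : jump G a' b' by apply/(jump_shift s) => //; [exact: pos | rewrite -aE -bE].
by have := le_k _ _ jab; rewrite aE bE /shift; lia.
Qed.

Lemma phi_inj {k g : nat} {G1 G2 : {fset nat}} :
  2 * g <= 3 * k -> 2 <= g ->
  pure_sparse_gapsets k g G1 -> pure_sparse_gapsets k g G2 ->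
  phi k G1 = phi k G2 -> G1 = G2.
Proof.
move=> hgk g2 G1A G2A.
have [s1 [j1 -> [gH gE _]]] := phi_pure_sparse hgk g2 G1A.
have [s2 [j2 -> _]] := phi_pure_sparse hgk g2 G2A => eqH.
have [[pos1 _] _ _] := G1A; have [[pos2 _] _ _] := G2A.
have jumpH (G : {fset nat}) s : (forall z, z \in G -> 0 < z) ->
    jump G s (s + k) -> jump (insert_shift s G) s.+1 (s.+1 + k.+1).
  move=> pos js; have [sG tG _ _] := js.
  have -> : s.+1 + k.+1 = shift s (s + k) by rewrite /shift; lia.
  have -> : s.+1 = shift s s by rewrite /shift; lia.
  by apply/jump_shift; rewrite ?pos //; apply/negP => /pos.
have {}j1 := jumpH _ _ pos1 j1; have {jumpH}j2 := jumpH _ _ pos2 j2.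
rewrite -eqH in j2.
(* Two different (k+1)-jumps of the common image cannot coexist: the later one would be too long for
   [gap_after_jump]. *)
have sE : s1 = s2.
  have [s12|s21|//] := ltngtP s1 s2.
    by have := gap_after_jump gH _ _ j1 j2; lia.
  by have := gap_after_jump gH _ _ j2 j1; lia.
apply/fsetP => -[|x].
  by apply/idP/idP => [/pos1|/pos2].
by rewrite -(mem_shift s1) // eqH sE mem_shift.
Qed.

Lemma phi_onto {k g : nat} {H : {fset nat}} :
  2 * g <= 3 * k -> 2 <= g -> pure_sparse_gapsets k.+1 g.+1 H ->
  exists2 G, pure_sparse_gapsets k g G & phi k G = H.
Proof.
move=> hgk g2 [gH gE psH]; have [posH _] := gH.
have H2 : 2 <= genus H by lia.
move: psH => /(pure_sparseP _ _ H2) [le_k [a ja]].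
have ak := jump_lower gH ja.
(* The start s of the jump in G is sent to s + 1, so the jump of H dictates where to undo the
   shift. *)
have [s aE] : exists s, a = s.+1 by exists a.-1; lia.
subst a.
have [G G0 HE] : exists2 G : {fset nat}, 0 \notin G & H = insert_shift s G.
  apply: insert_shift_onto; first by apply/negP => /posH.
    by apply: (below_jump gH ja); lia.
  by have [_ _ _ nb] := ja; apply: nb; lia.
have {}gE : genus G = g by move: gE; rewrite HE genus_insert_shift //; lia.
have js : jump G s (s + k).
  apply/(jump_shift s) => //; try lia.
  have <- : s.+1 + k.+1 = shift s (s + k) by rewrite /shift; lia.
  have <- : s.+1 = shift s s by rewrite /shift; lia.
  by rewrite -HE.
have gG : gapset G.
  by apply: (gapset_insert_shift_inv G0 _ _ js); rewrite -?HE ?gE.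
have [pos _] := gG.
(* For integers, 2g <= 3k is equivalent to 2(g + 1) < 3(k + 1), the strict form that
   [gap_after_jump] asks for. *)
have genusH : 2 * genus H < 3 * k.+1 by rewrite HE genus_insert_shift //; lia.
have to_H a b : jump G a b -> jump H (shift s a) (shift s b).
  by move=> jab; have [aG bG _ _] := jab; rewrite HE; apply/jump_shift; rewrite ?pos.
have after a b : jump G a b -> s < a -> b < a + k.
  move=> /to_H jab sa.
  have := gap_after_jump gH genusH ltac:(lia) ja jab; rewrite /shift; lia.
have sl : last_jump_at k G s.
  by split=> // a sa /after; lia.
exists G; last by rewrite HE; apply: phiE => //; rewrite gE.
split=> //; apply/pure_sparseP; first by rewrite gE.
split; last by exists s.
move=> a b jab; have [sa|as_|e] := ltngtP s a.
- by have := after a b jab sa; lia.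
- have [sG _ _ _] := js; have [_ _ _ nb] := jab.
  have bs : b <= s.
    by rewrite leqNgt; apply/negP => sb; have := nb s; rewrite sG => /(_ ltac:(lia)).
  (* Before s the shift keeps lengths. A jump of length k + 1 here would be an earlier (k+1)-jump of
     H, making the one at s + 1 too long. *)
  have := le_k _ _ (to_H _ _ jab); rewrite leq_eqVlt => /orP[/eqP e|].
    have jab' := to_H _ _ jab; rewrite e in jab'.
    by have := gap_after_jump gH genusH ltac:(lia) jab' ja; rewrite /shift; lia.
  by rewrite /shift; lia.
by have := le_k _ _ (to_H _ _ jab); have [_ _ ab _] := jab; rewrite /shift; lia.
Qed.

(** * Small genus and conclusion *)

Lemma pure_sparse_gapsets0 k G :
  pure_sparse_gapsets k 0 G <-> G = fset0 /\ k = 0.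
Proof.
split=> [[_ gE [//|[G1 _]|[]]]|[-> ->]]; last 1 first.
- by split; [split | rewrite /genus cardfs0 | apply: Or31].
- by move: gE; rewrite G1 /genus cardfs1.
by rewrite gE.
Qed.

Lemma pure_sparse_gapsets1 k G :
  pure_sparse_gapsets k 1 G <-> G = [fset 1]%fset /\ k = 1.
Proof.
split=> [[_ gE [[G0 _]|//|[]]]|[-> ->]]; last 1 first.
- split; [split | by rewrite /genus cardfs1 | by apply: Or32].
    by move=> z; rewrite inE => /eqP ->.
  by move=> x y x0 y0; rewrite !inE; lia.
- by move: gE; rewrite G0 /genus cardfs0.
by rewrite gE.
Qed.

(** Gaps are at most 3, so a jump of length at least 2 runs from 1 to 3; [1 < k] excludes {1, 2}. *)
Lemma pure_sparse_gapsets2 k G : 1 < k ->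
  pure_sparse_gapsets k 2 G <-> G = [fset 1; 3]%fset /\ k = 2.
Proof.
have c13 : #|` [fset 1; 3]%fset| = 2 by rewrite cardfs2.
move=> k1; split=> [[gG gE psG]|[-> ->]].
  have g2 : 2 <= genus G by rewrite gE.
  have [pos _] := gG.
  move: psG => /(pure_sparseP _ _ g2) [_ [a [aG bG _ _]]].
  have a0 := pos _ aG; have := gapset_max gG bG; rewrite gE => b4.
  have a1 : a = 1 by lia.
  have k2 : k = 2 by lia.
  subst; split=> //; apply/esym/eqP.
  rewrite eqEfcard c13 -/(genus G) gE leqnn andbT.
  by apply/fsubsetP => x; rewrite !inE => /orP[] /eqP ->.
have g2 : genus [fset 1; 3]%fset = 2 by [].
split=> //.
  split=> [z|x y x0 y0]; rewrite !inE; first by lia.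
  by move=> h; apply/orP; lia.
apply/pure_sparseP; first by rewrite g2.
split=> [a b [+ + _ _]|]; first by rewrite !inE; lia.
by exists 1; split; rewrite ?inE // => x hx; rewrite !inE; lia.
Qed.

Lemma fset1_neq0 : ([fset 1]%fset == fset0 :> {fset nat}) = false.
Proof. by rewrite -cardfs_eq0 cardfs1. Qed.

Theorem theorem5p1 (g kappa : nat) (hgk : 2 * g <= 3 * kappa) :
  (forall G : {fset nat},
      pure_sparse_gapsets kappa g G ->
      pure_sparse_gapsets kappa.+1 g.+1 (phi kappa G)) /\
  set_bij (pure_sparse_gapsets kappa g) (pure_sparse_gapsets kappa.+1 g.+1)
    (phi kappa).
Proof.
suff [maps inj surj] : [/\
    forall G, pure_sparse_gapsets kappa g G ->
      pure_sparse_gapsets kappa.+1 g.+1 (phi kappa G),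
    forall G1 G2, pure_sparse_gapsets kappa g G1 ->
      pure_sparse_gapsets kappa g G2 -> phi kappa G1 = phi kappa G2 -> G1 = G2
  & forall H, pure_sparse_gapsets kappa.+1 g.+1 H ->
      exists2 G, pure_sparse_gapsets kappa g G & phi kappa G = H].
  split=> //; split=> //.
  by move=> G1 G2 /set_mem A1 /set_mem A2; apply: inj.
(* In genus 0 and 1, where [phi] is given by convention, source and target have at most one element
   each. *)
case: g hgk => [|[|g]] hgk.
- split=> [G /pure_sparse_gapsets0[-> ->]|G1 G2|H /pure_sparse_gapsets1[-> [k0]]].
  + by rewrite /phi eqxx; apply/pure_sparse_gapsets1.
  + by move=> /pure_sparse_gapsets0[-> _] /pure_sparse_gapsets0[-> _].
  exists fset0; first by apply/pure_sparse_gapsets0.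
  by rewrite /phi eqxx.
- split=> [G /pure_sparse_gapsets1[-> ->]|G1 G2|H].
  + by rewrite /phi fset1_neq0 eqxx; apply/pure_sparse_gapsets2.
  + by move=> /pure_sparse_gapsets1[-> _] /pure_sparse_gapsets1[-> _].
  have k1 : 1 < kappa.+1 by lia.
  move=> /(pure_sparse_gapsets2 _ _ k1)[-> [k0]].
  exists [fset 1]%fset; first by apply/pure_sparse_gapsets1.
  by rewrite /phi fset1_neq0 eqxx.
split=> [G GA|G1 G2|H].
- by have [s [_ -> ]] := phi_pure_sparse hgk isT GA.
- exact: phi_inj.
exact: phi_onto.
Qed.
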